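(* Let $G$ be a finitely generated group. If there is a nonempty convex polytope $K\subset S(G)$ which is contained in an open hemisphere of $S(G)$, has rational vertices, and is invariant under all homeomorphisms $\varphi^*:S(G)\to S(G)$, $\varphi^*[\chi]=[\chi\circ\varphi]$, induced by automorphisms $\varphi$ of $G$, then $G$ has property $R_\infty$. In particular, if $\Sigma^1(G)^c$ is one such polytope, then $G$ has property $R_\infty$.
   Context: Character sphere: $S(G)=(\mathrm{Hom}(G,\mathbb{R})\setminus\{0\})/\sim$, where $\chi\sim\chi'$ iff $r\chi=\chi'$ for some real $r>0$; $[\chi]$ denotes the class of $\chi$. Let $n$ be the free rank of $G^{ab}$ and $x_1,\dots,x_n\in G$ elements mapping to a basis of $G^{ab}$ modulo torsion; then $\mathfrak h:S(G)\to S^{n-1}$, $\mathfrak h[\chi]=(\chi(x_1),\dots,\chi(x_n))/\|(\chi(x_1),\dots,\chi(x_n))\|$, is a homeomorphism. An open hemisphere of $S^{n-1}$ is a set $O(v)=\{x\in S^{n-1}\mid\langle x,v\rangle>0\}$, and a closed hemisphere is a set $C(w)=\{x\in S^{n-1}\mid\langle x,w\rangle\ge 0\}$, with $v,w\in S^{n-1}$; the open hemispheres of $S(G)$ are the preimages under $\mathfrak h$. A convex polytope in $S^{n-1}$ is a finite intersection of closed hemispheres; $K\subset S(G)$ is a convex polytope if $\mathfrak h(K)$ is. Vertices: if $\mathfrak h(K)\subset O(v)$, the homeomorphism $\theta_v:v+\{v\}^\perp\to O(v)$, $\theta_v(P)=P/\|P\|$, from the affine hyperplane $v+\{v\}^\perp$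 identifies $\mathfrak h(K)$ with a Euclidean convex polytope $\theta_v^{-1}(\mathfrak h(K))$; the vertices of $K$ are the points corresponding to the vertices of this Euclidean polytope. A point of $S(G)$ is rational if it equals $[\chi]$ for some $\chi$ with $\chi(G)\subset\mathbb{Q}$. Invariance of $K$ means $\varphi^*(K)=K$ for every $\varphi\in\mathrm{Aut}(G)$. $\Sigma^1(G)=\{[\chi]\in S(G)\mid\Gamma_\chi\text{ is connected}\}$, where, for a finite generating set $X$ of $G$, $\Gamma_\chi$ is the full subgraph, on the vertices $g$ with $\chi(g)\ge 0$, of the Cayley graph with vertex set $G$ and edges joining $g$ and $gy$ ($y\in X\cup X^{-1}$); $\Sigma^1(G)^c$ is its complement in $S(G)$. Property $R_\infty$: for every $\varphi\in\mathrm{Aut}(G)$ the number $R(\varphi)$ of equivalence classes of the relation on $G$ given by $g\sim h\iff zg\varphi(z)^{-1}=h$ for some $z\in G$ is infinite. *)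

(* Defs.v *)
From HB Require Import structures.
From mathcomp Require Import all_boot all_order all_algebra.
From mathcomp Require Import all_classical all_reals.

Set Implicit Arguments.
Unset Strict Implicit.
Unset Printing Implicit Defensive.

Import Order.TTheory GRing.Theory Num.Theory.
Local Open Scope classical_set_scope.
Local Open Scope quotient_scope.
Local Open Scope ring_scope.

Definition subgroup_generated (G : groupType) (A : set G) : set G :=
  smallest [set H : set G | group_closed [in H]] A.

Definition generates (G : groupType) (X : seq G) : Prop :=
  subgroup_generated [set` X] = [set: G].

Definition finitely_generated (G : groupType) : Prop :=
  exists X : seq G, generates X.

Definition commutator_subgroup (G : groupType) : set G :=
  subgroup_generated [set g : G | exists a b : G, g = [~ a, b]%g].

(* The kernel of the projection from G onto G^ab modulo torsion. *)
Definition abelianization_torsion (G : groupType) : set G :=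
  [set g | exists2 k : nat, (0 < k)%N & commutator_subgroup (g ^+ k)%g].

Definition zexpg (G : groupType) (g : G) (a : int) : G :=
  match a with
  | Posz k => (g ^+ k)%g
  | Negz k => (g ^- k.+1)%g
  end.

(* The classes of the x_i form a Z-basis of G^ab modulo torsion: each class is
   an integer combination of them in exactly one way.  In particular n is the
   free rank of G^ab. *)
Definition basis_mod_torsion (G : groupType) (n : nat) (x : 'I_n -> G) : Prop :=
  forall g : G, exists! a : {ffun 'I_n -> int},
    abelianization_torsion ((\prod_(i < n) zexpg (x i) (a i))^-1 * g)%g.

Record group_aut (G : groupType) := GroupAut {
  aut_mor :> {multiplicative G -> G};
  aut_bij : bijective aut_mor }.

Definition twisted_conj (G : groupType) (phi : group_aut G) (g h : G) : Prop :=
  exists z : G, (z * g * (phi z)^-1)%g = h.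

Definition reidemeister_classes (G : groupType) (phi : group_aut G) :
    set (set G) :=
  range (fun g : G => [set h | twisted_conj phi g h]).

Definition property_R_infty (G : groupType) : Prop :=
  forall phi : group_aut G, infinite_set (reidemeister_classes phi).

Definition nonzero_character (R : realType) (G : groupType) : set (G -> R) :=
  [set chi | {morph chi : g h / (g * h)%g >-> g + h} /\ exists g, chi g != 0].

Record nzchar (R : realType) (G : groupType) := NzChar {
  nzchar_fun :> G -> R;
  nzcharP : nzchar_fun \in @nonzero_character R G }.

HB.instance Definition _ (R : realType) (G : groupType) :=
  [isSub for @nzchar_fun R G].
HB.instance Definition _ (R : realType) (G : groupType) :=
  [Choice of nzchar R G by <:].

Definition pos_prop (R : realType) (G : groupType) : rel (nzchar R G) :=
  fun chi chi' => `[< exists2 r : R, 0 < r & forall g, r * chi g = chi' g >].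

Lemma pos_prop_refl (R : realType) (G : groupType) : reflexive (@pos_prop R G).
Proof. by move=> chi; apply/asboolP; exists 1 => // g; rewrite mul1r. Qed.

Lemma pos_prop_sym (R : realType) (G : groupType) : symmetric (@pos_prop R G).
Proof.
have half (chi chi' : nzchar R G) : pos_prop chi chi' -> pos_prop chi' chi.
  move=> /asboolP[r r0 e]; apply/asboolP; exists r^-1; first by rewrite invr_gt0.
  by move=> g; rewrite -e mulKf// gt_eqF.
by move=> chi chi'; apply/idP/idP; apply: half.
Qed.

Lemma pos_prop_trans (R : realType) (G : groupType) : transitive (@pos_prop R G).
Proof.
move=> c2 c1 c3 /asboolP[r r0 e] /asboolP[s s0 e']; apply/asboolP.
by exists (s * r); [rewrite mulr_gt0|move=> g; rewrite -mulrA e].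
Qed.

Canonical pos_prop_equiv (R : realType) (G : groupType) :=
  EquivRel (@pos_prop R G) (@pos_prop_refl R G) (@pos_prop_sym R G)
    (@pos_prop_trans R G).

Notation char_sphere R G := {eq_quot @pos_prop R G}.

Definition char_class (R : realType) (G : groupType) (chi : nzchar R G) :
  char_sphere R G := \pi chi.

Lemma pos_prop_repr (R : realType) (G : groupType) (chi : nzchar R G) :
  pos_prop (repr (char_class chi)) chi.
Proof. by apply/eqmodP; rewrite reprK. Qed.

Lemma pullback_subproof (R : realType) (G : groupType) (phi : group_aut G)
    (chi : nzchar R G) : (chi \o phi) \in @nonzero_character R G.
Proof.
have /set_mem[chiM [g chig]] := nzcharP chi; apply/mem_set; split.
  by move=> a b /=; rewrite gmulfM chiM.
by have [psi _ psiK] := aut_bij phi; exists (psi g); rewrite /= psiK.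
Qed.

Definition pullback (R : realType) (G : groupType) (phi : group_aut G)
  (chi : nzchar R G) : nzchar R G := NzChar (pullback_subproof phi chi).

Definition sphere_map (R : realType) (G : groupType) (phi : group_aut G)
  (p : char_sphere R G) : char_sphere R G := char_class (pullback phi (repr p)).

Lemma sphere_mapE (R : realType) (G : groupType) (phi : group_aut G)
  (chi : nzchar R G) :
  sphere_map phi (char_class chi) = char_class (pullback phi chi).
Proof.
apply/eqmodP; have /asboolP[r r0 e] := pos_prop_repr chi.
by apply/asboolP; exists r => // g; apply: e.
Qed.

Definition aut_invariant (R : realType) (G : groupType)
    (K : set (char_sphere R G)) : Prop :=
  forall phi : group_aut G, sphere_map phi @` K = K.

Definition rational_point (R : realType) (G : groupType)
    (p : char_sphere R G) : Prop :=
  exists2 chi : nzchar R G,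
    p = char_class chi & forall g, exists q : rat, chi g = ratr q.

Definition dot (R : realType) (n : nat) (u v : 'rV[R]_n) : R :=
  \sum_(i < n) u 0 i * v 0 i.

(* The library norm on row vectors is the sup norm, hence this one. *)
Definition enorm (R : realType) (n : nat) (u : 'rV[R]_n) : R :=
  Num.sqrt (dot u u).

Definition normalize (R : realType) (n : nat) (u : 'rV[R]_n) : 'rV[R]_n :=
  (enorm u)^-1 *: u.

Definition unit_sphere (R : realType) (n : nat) : set 'rV[R]_n :=
  [set u | enorm u = 1].

Definition open_hemisphere (R : realType) (n : nat) (v : 'rV[R]_n) :
  set 'rV[R]_n := [set u | unit_sphere u /\ 0 < dot u v].

Definition closed_hemisphere (R : realType) (n : nat) (w : 'rV[R]_n) :
  set 'rV[R]_n := [set u | unit_sphere u /\ 0 <= dot u w].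

(* Intersecting with the sphere only matters for the empty list of
   hemispheres. *)
Definition spherical_polytope (R : realType) (n : nat) (Q : set 'rV[R]_n) :
    Prop :=
  exists ws : seq 'rV[R]_n, (forall w, w \in ws -> unit_sphere w) /\
    Q = @unit_sphere R n `&` \bigcap_(w in [set` ws]) closed_hemisphere w.

(* v + {v}^perp, not through the origin *)
Definition tangent_hyperplane (R : realType) (n : nat) (v : 'rV[R]_n) :
  set 'rV[R]_n := [set v + u | u in [set u | dot u v = 0]].

(* theta_v^-1(Q), for Q contained in the open hemisphere centred at v. *)
Definition flatten_polytope (R : realType) (n : nat) (v : 'rV[R]_n)
    (Q : set 'rV[R]_n) : set 'rV[R]_n :=
  tangent_hyperplane v `&` @normalize R n @^-1` Q.

(* Vertices of a Euclidean polytope are its extreme points. *)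
Definition euclidean_vertex (R : realType) (n : nat) (Q : set 'rV[R]_n)
    (P : 'rV[R]_n) : Prop :=
  Q P /\ forall (A B : 'rV[R]_n) (t : R), Q A -> Q B -> 0 < t < 1 ->
    P = t *: A + (1 - t) *: B -> A = P /\ B = P.

Definition char_coord (R : realType) (G : groupType) (n : nat) (x : 'I_n -> G)
  (chi : G -> R) : 'rV[R]_n := \row_(i < n) chi (x i).

Definition sphere_coord (R : realType) (G : groupType) (n : nat)
    (x : 'I_n -> G) (p : char_sphere R G) : 'rV[R]_n :=
  normalize (char_coord x (repr p)).

Lemma sphere_coordE (R : realType) (G : groupType) (n : nat) (x : 'I_n -> G)
    (chi : nzchar R G) :
  sphere_coord x (char_class chi) = normalize (char_coord x chi).
Proof.
have /asboolP[r r0 e] := pos_prop_repr chi.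
have -> : char_coord x chi = r *: char_coord x (repr (char_class chi)).
  by apply/rowP => i; rewrite !mxE e.
rewrite /sphere_coord; move: (char_coord _ _) => u.
rewrite /normalize; have -> : enorm (r *: u) = r * enorm u.
  rewrite /enorm; have -> : dot (r *: u) (r *: u) = r ^+ 2 * dot u u.
    by rewrite /dot mulr_sumr; apply: eq_bigr => i _; rewrite !mxE mulrACA expr2.
  by rewrite sqrtrM ?sqr_ge0// sqrtr_sqr gtr0_norm.
by rewrite scalerA invfM mulrAC mulVf ?gt_eqF// mul1r.
Qed.

Definition convex_polytope (R : realType) (G : groupType) (n : nat)
    (x : 'I_n -> G) (K : set (char_sphere R G)) : Prop :=
  spherical_polytope (sphere_coord x @` K).

Definition sphere_open_hemisphere (R : realType) (G : groupType) (n : nat)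
    (x : 'I_n -> G) (v : 'rV[R]_n) : set (char_sphere R G) :=
  sphere_coord x @^-1` open_hemisphere v.

(* Vertices of K, computed in the hyperplane v + {v}^perp; meaningful when K
   lies in the open hemisphere centred at v. *)
Definition vertices (R : realType) (G : groupType) (n : nat) (x : 'I_n -> G)
    (v : 'rV[R]_n) (K : set (char_sphere R G)) : set (char_sphere R G) :=
  [set p | exists2 P : 'rV[R]_n,
     euclidean_vertex (flatten_polytope v (sphere_coord x @` K)) P &
     normalize P = sphere_coord x p].

Definition rational_hemispherical_polytope (R : realType) (G : groupType)
    (n : nat) (x : 'I_n -> G) (K : set (char_sphere R G)) : Prop :=
  [/\ K !=set0,
      convex_polytope x K &
      exists v : 'rV[R]_n,
        [/\ unit_sphere v,
            K `<=` sphere_open_hemisphere x v &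
            vertices x v K `<=` @rational_point R G]].

Definition cayley_edge (G : groupType) (X : seq G) : rel G :=
  fun g h => has (fun y => (h == g * y)%g || (h == g * y^-1)%g) X.

Definition halfspace_connected (R : realType) (G : groupType) (X : seq G)
    (chi : G -> R) : Prop :=
  forall g h : G, 0 <= chi g -> 0 <= chi h ->
    exists p : seq G,
      [/\ path (cayley_edge X) g p, all (fun k => 0 <= chi k) p & last g p = h].

(* X is a finite generating set; connectedness is on the full subgraph spanned
   by the vertices where chi is nonnegative. *)
Definition Sigma1 (R : realType) (G : groupType) (X : seq G) :
    set (char_sphere R G) :=
  [set p | exists2 chi : nzchar R G,
     p = char_class chi & halfspace_connected X chi].

(* Main.v *)
Require Import Defs.
From HB Require Import structures.
From mathcomp Require Import all_boot all_order all_algebra.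
From mathcomp Require Import all_classical all_reals.

Set Implicit Arguments.
Unset Strict Implicit.
Unset Printing Implicit Defensive.

Import Order.TTheory GRing.Theory Num.Theory.
Local Open Scope classical_set_scope.
Local Open Scope quotient_scope.
Local Open Scope ring_scope.

(** The theorem reduces to finding, for each automorphism [phi], a nonzero
    character [chi : G -> R] with [chi \o phi = chi]: such a [chi] is constant
    on twisted conjugacy classes and takes infinitely many values, so there are
    infinitely many classes ([infinite_reidemeister]).

    To find it, replace the polytope [K] by the cone of characters
    representing its points together with [0] ([polytope_cone]).  By
    definition of a polytope this cone is cut out of the space of additive
    characters by finitely many linear inequalities, it is pointed because [K]
    lies in an open hemisphere, and composition with [phi] acts on it by linear
    automorphisms.  Its extreme rays are the vertices of [K], hence rational
    ([extreme_rational]).  An extreme ray exists ([exists_extreme]), and it is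
    determined by the set of inequalities that it saturates
    ([active_extreme]), so there are only finitely many of them.  Following
    one extreme character along [phi], [phi^2], ..., some power [phi^k] must
    therefore map an extreme character [chi] of the orbit to a multiple
    [r chi], with [r > 0] ([pigeonhole_extreme]).

    Rationality forces [r = 1]: after rescaling, [chi] is rational valued, so
    its image is a nonzero finitely generated group of rationals, hence
    discrete, and multiplication by [r] maps this image onto itself
    ([rational_character_scale_eq1]).  Then the sum of [chi \o phi^i] over
    [0 <= i < k] is fixed by [phi], and it is nonzero because every summand has a
    positive inner product with the centre of the hemisphere
    ([exists_fixed_character]).

    For the second assertion, [phi] carries the half-space graph of
    [chi \o phi] for [X] to that of [chi] for the generating set [phi(X)].
    Connectedness of the half-space graph does not depend on the generating
    set ([halfspace_connected_generators]), so the complement of [Sigma1] is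
    invariant under all automorphisms. *)

(** * Characters and twisted conjugacy classes *)

Lemma subgroup_generated_sub (G : groupType) (A : set G) (P : G -> Prop) :
  P 1%g -> (forall a b, P a -> P b -> P (a * b^-1)%g) -> (A `<=` P) ->
  subgroup_generated A `<=` P.
Proof.
move=> P1 PD AP; apply: (@smallest_sub _ _ _ P) => //; split.
  by rewrite inE.
by move=> a b; rewrite !inE; exact: PD.
Qed.

Lemma generates_ind (G : groupType) (X : seq G) (P : G -> Prop) :
  generates X -> P 1%g -> (forall a b, P a -> P b -> P (a * b^-1)%g) ->
  (forall y, y \in X -> P y) -> forall g, P g.
Proof.
move=> gX P1 PD PX g; apply: (subgroup_generated_sub P1 PD PX).
by rewrite [X in X g]gX.
Qed.

Definition additive_character (R : realType) (G : groupType) (chi : G -> R) :=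
  {morph chi : g h / (g * h)%g >-> g + h}.

Section AdditiveCharacter.
Variables (R : realType) (G : groupType) (chi : G -> R).
Hypothesis chiM : additive_character chi.

Lemma character1 : chi 1%g = 0.
Proof. by apply: (addIr (chi 1%g)); rewrite add0r -chiM mulg1. Qed.

Lemma characterV g : chi g^-1%g = - chi g.
Proof. by apply/eqP; rewrite -addr_eq0 -chiM mulVg character1. Qed.

Lemma characterX g k : chi (g ^+ k)%g = chi g *+ k.
Proof.
elim: k => [|k IH]; first by rewrite expg0 character1 mulr0n.
by rewrite expgS chiM IH mulrS.
Qed.

Lemma character_zexpg g a : chi (zexpg g a) = chi g *~ a.
Proof. by case: a => k /=; rewrite ?characterV characterX. Qed.

Lemma character_commutator g : commutator_subgroup g -> chi g = 0.
Proof.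
apply: (subgroup_generated_sub (P := fun g => chi g = 0)).
- exact: character1.
- by move=> a b a0 b0; rewrite chiM characterV a0 b0 subr0.
move=> _ [a [b ->]]; rewrite /commg /conjg !chiM !characterV.
by rewrite (addrC (chi a)) addKr addNr.
Qed.

Lemma character_torsion g : abelianization_torsion g -> chi g = 0.
Proof.
move=> [k k0 /character_commutator]; rewrite characterX => /eqP.
by rewrite mulrn_eq0 gtn_eqF//= => /eqP.
Qed.

(** A character is determined by its coordinates because it kills every element
    having a power in the commutator subgroup. *)
Lemma character_basis_eq0 (n : nat) (x : 'I_n -> G) : basis_mod_torsion x ->
  (forall i, chi (x i) = 0) -> forall g, chi g = 0.
Proof.
move=> hx chix0 g; have [a [/character_torsion]] := hx g.
rewrite chiM characterV.
rewrite (big_ind (fun h => chi h = 0)) ?oppr0 ?add0r//.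
- exact: character1.
- by move=> p q p0 q0; rewrite chiM p0 q0 addr0.
- by move=> i _; rewrite character_zexpg chix0 mul0rz.
Qed.

End AdditiveCharacter.

Lemma group_aut1 (G : groupType) (phi : group_aut G) : phi 1%g = 1%g.
Proof. by apply: (mulgI (phi 1%g)); rewrite -gmulfM !mulg1. Qed.

(** The classes of the powers of an element outside the kernel of [chi] are
    separated by [chi]. *)
Lemma infinite_reidemeister (R : realType) (G : groupType) (phi : group_aut G)
    (chi : G -> R) :
  additive_character chi -> (exists g, chi g != 0) ->
  (forall g, chi (phi g) = chi g) -> infinite_set (reidemeister_classes phi).
Proof.
move=> chiM [g0 g0n0] chiphi fin.
pose f (k : nat) := [set h | twisted_conj phi (g0 ^+ k)%g h].
have twistE g h : twisted_conj phi g h -> chi h = chi g.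
  by move=> [z <-]; rewrite !chiM characterV// chiphi addrAC subrr add0r.
apply: infinite_nat.
have -> : [set: nat] = f @^-1` reidemeister_classes phi.
  by apply/seteqP; split=> k // _; exists (g0 ^+ k)%g.
apply: finite_preimage fin => k m _ _ fkm.
have : f m (g0 ^+ m)%g by exists 1%g; rewrite group_aut1 mul1g invg1 mulg1.
by rewrite -fkm => /twistE; rewrite !characterX// => /(mulrIn g0n0) ->.
Qed.

(** Finitely many generators have a common denominator, and the values that it
    clears form a subgroup. *)
Lemma rational_character_denominator (R : realType) (G : groupType)
    (chi : G -> R) :
  finitely_generated G -> additive_character chi ->
  (forall g, exists q : rat, chi g = ratr q) ->
  exists2 N : nat, (0 < N)%N & forall g, N%:R * chi g \is a Num.int.
Proof.
move=> [X gX] chiM chiQ.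
have [N N0 NX] : exists2 N : nat, (0 < N)%N &
    forall y, y \in X -> N%:R * chi y \is a Num.int.
  elim: X {gX} => [|y X [N N0 NX]]; first by exists 1%N.
  have [q qE] := chiQ y.
  have dE : denq q = `|denq q|%N by rewrite absz_denq.
  exists (N * `|denq q|)%N; first by rewrite muln_gt0 N0 absz_gt0 denq_neq0.
  move=> z; rewrite inE => /orP[/eqP ->|zX]; last first.
    by rewrite natrM mulrAC rpredM ?NX// natr_int.
  rewrite natrM -mulrA rpredM ?natr_int//.
  rewrite pmulrn -dE qE mulrC -[(denq q)%:~R]ratr_int -rmorphM /=.
  by rewrite -numqE ratr_int intr_int.
exists N => //; apply: (generates_ind gX) => //.
  by rewrite (character1 chiM) mulr0 int_num0.
by move=> a b aN bN; rewrite chiM (characterV chiM) mulrBr rpredB.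
Qed.

(** The image of [chi] is stable under multiplication by [r] and by its
    inverse, and it is discrete: its smallest positive element [d] satisfies
    [d <= r d] and [d <= d / r]. *)
Lemma rational_character_scale_eq1 (R : realType) (G : groupType)
    (chi : G -> R) (theta : G -> G) (r : R) :
  finitely_generated G -> additive_character chi ->
  (forall g, exists q : rat, chi g = ratr q) -> (exists g, chi g != 0) ->
  (forall g, exists h, theta h = g) -> 0 < r ->
  (forall g, chi (theta g) = r * chi g) -> r = 1.
Proof.
move=> fgG chiM chiQ [g0 g0n0] theta_surj r0 chir.
have [N N0 Nint] := rational_character_denominator fgG chiM chiQ.
(* [N chi] is integer valued; [d] is the least of its nonzero
   absolute values. *)
pose P (k : nat) := (0 < k)%N && `[< exists g, `|N%:R * chi g| = k%:R >].
have abs_nat g : exists k : nat, `|N%:R * chi g| = k%:R.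
  have := Nint g => /intrP[m ->]; exists `|m|%N.
  by rewrite -intr_norm pmulrn abszE.
have Nn0 : N%:R != 0 :> R by rewrite pnatr_eq0 -lt0n.
have exP : exists k, P k.
  have [k kE] := abs_nat g0; exists k; apply/andP; split; last first.
    by apply/asboolP; exists g0.
  by rewrite -(ltr_nat R) -kE normr_gt0 mulf_neq0.
case: (ex_minnP exP) => d /andP[d0 /asboolP[g gE]] mind.
have dmin h : chi h != 0 -> d%:R <= `|N%:R * chi h|.
  move=> hn0; have [k kE] := abs_nat h; rewrite kE ler_nat mind//.
  apply/andP; split; last by apply/asboolP; exists h.
  by rewrite -(ltr_nat R) -kE normr_gt0 mulf_neq0.
have scale h : `|N%:R * chi (theta h)| = r * `|N%:R * chi h|.
  by rewrite chir mulrCA normrM gtr0_norm.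
have dR0 : 0 < d%:R :> R by rewrite ltr0n.
have neq0 h : `|N%:R * chi h| != 0 -> chi h != 0.
  by apply: contra_neq => ->; rewrite mulr0 normr0.
apply/eqP; rewrite eq_le; apply/andP; split.
  have [h hg] := theta_surj g.
  have := scale h; rewrite hg gE => dE.
  have hn0 : chi h != 0.
    apply: neq0; apply/eqP => h0; move: dE dR0.
    by rewrite h0 mulr0 => ->; rewrite ltxx.
  by rewrite -(ler_pM2r dR0) mul1r [leRHS]dE ler_wpM2l ?dmin// ltW.
have gn0 : chi g != 0 by apply: neq0; rewrite gE gt_eqF.
rewrite -(ler_pM2r dR0) mul1r -[in leRHS]gE -scale dmin//.
by rewrite chir mulf_neq0// gt_eqF.
Qed.

Lemma exists_inverse_aut (G : groupType) (phi : group_aut G) :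
  exists psi : group_aut G, cancel phi psi /\ cancel psi phi.
Proof.
have [psi phiK psiK] := aut_bij phi.
have psiM : {morph psi : g h / (g * h)%g} by exact: can2_gmulfM.
pose m : {multiplicative G -> G} :=
  HB.pack psi (isMultiplicative.Build G G psi psiM).
have m_bij : bijective m by exists phi.
by exists (GroupAut m_bij).
Qed.

(** * Extreme rays of polyhedral cones *)

(** For a pointed cone [C], the condition says that [u] spans an extreme ray.
    It mentions neither coordinates nor inequalities, so that linear
    automorphisms of [C] visibly preserve it. *)
Definition extreme (R : realFieldType) (V : lmodType R) (C : set V) (u : V) :=
  [/\ C u, u != 0 &
      forall a b, C a -> C b -> u = a + b -> exists s, a = s *: u].

(* The subspace [S] leaves room for an ambient space larger than the one in
   which the cone lives, such as all functions around additive characters. *)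
Section PolyhedralCone.
Variables (R : realFieldType) (V : lmodType R) (S : set V).
Hypothesis S_lin : forall (k : R) (u v : V), S u -> S v -> S (k *: u + v).
Variables (I : finType) (l : I -> {scalar V}).

Definition polyhedral_cone : set V := [set u | S u /\ forall i, 0 <= l i u].

Definition active (u : V) : {set I} := [set i | l i u == 0].

(** Since [w] saturates the constraints that [u] saturates, [u - e *: w] stays
    in the cone for small [e > 0]; then [u] is the sum of [e *: w] and
    [u - e *: w], and extremality puts [w] on the ray of [u]. *)
Lemma active_extreme (u w : V) :
  extreme polyhedral_cone u -> polyhedral_cone w -> active u \subset active w ->
  exists s, w = s *: u.
Proof.
move=> [[Su lu] u0 uext] [Sw lw] uw.
have [e e0 le_e] : exists2 e : R, 0 < e & forall i, e * l i w <= l i u.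
  (* The [1 +] keeps the denominator positive when [l i w = 0]. *)
  exists (\big[Num.min/1]_(i | l i u != 0) (l i u / (1 + l i w))).
    apply: (big_ind (fun y => 0 < y)) => [//|a b a0 b0|i iu].
      by rewrite lt_min a0.
    by rewrite divr_gt0// ?ltr_wpDr// lt_def iu lu.
  move=> i; have [iu0|iu] := eqVneq (l i u) 0.
    have /(fintype.subsetP uw) : i \in active u by rewrite inE iu0.
    by rewrite inE => /eqP ->; rewrite mulr0.
  have d0 : 0 < 1 + l i w by rewrite ltr_wpDr.
  apply: (@le_trans _ _ (l i u / (1 + l i w) * l i w)).
    apply: ler_wpM2r => //; exact: bigmin_le_cond.
  by rewrite mulrAC -mulrA ler_piMr// ler_pdivrMr// mul1r lerDr.
have S0 : S 0 by have := S_lin (-1) Su Su; rewrite scaleN1r addNr.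
have [|||s es] := uext (e *: w) (u - e *: w).
- by split=> [|i]; [rewrite -[_ *: _]addr0; exact: S_lin|
    rewrite linearZ /= mulr_ge0// ltW].
- split=> [|i]; first by rewrite addrC -scaleNr; exact: S_lin.
  by rewrite linearB linearZ /= subr_ge0.
- by rewrite addrC subrK.
exists (e^-1 * s); rewrite -scalerA -es scalerA mulVf ?scale1r//.
by rewrite gt_eqF.
Qed.

(** The ray of an extreme vector is determined by its active set, and there are
    finitely many active sets. *)
Lemma pigeonhole_extreme (u : nat -> V) :
  (forall k, extreme polyhedral_cone (u k)) ->
  exists i j s, (i < j)%N /\ u j = s *: u i.
Proof.
move=> uext.
pose f (k : 'I_(#|{set I}|).+1) := active (u k).
have /injectivePn[i [j ij fij]] : ~~ injectiveb f.
  apply/injectiveP => /leq_card; rewrite card_ord; by rewrite ltnn.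
have ray (p q : 'I_(#|{set I}|).+1) :
    f p = f q -> exists s, u q = s *: u p.
  move=> e; apply: active_extreme => //; first by case: (uext q).
  by rewrite -/(f p) e.
case: (ltngtP i j) => [lt_ij|lt_ji|/val_inj e].
- by have [s es] := ray _ _ fij; exists i, j, s.
- by have [s es] := ray _ _ (esym fij); exists j, i, s.
- by rewrite e eqxx in ij.
Qed.

(** A nonzero point [u] of the cone saturating the largest number of constraints
    spans an extreme ray.  If [w] saturates at least the same constraints,
    subtract from [u] the largest multiple of [w] that keeps it in the cone; a
    further constraint becomes active, so by maximality the difference is [0].
    Positivity of [l0] rules out that the cone contains a line, which is what
    makes the largest multiple finite. *)
Lemma exists_extreme (l0 : {scalar V}) :
  (forall u, polyhedral_cone u -> u != 0 -> 0 < l0 u) ->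
  (exists2 u, polyhedral_cone u & u != 0) ->
  exists u, extreme polyhedral_cone u.
Proof.
move=> l0_gt0 [u1 Cu1 u1n0].
pose P k := `[< exists u, [/\ polyhedral_cone u, u != 0 & #|active u| = k] >].
have exP : exists k, P k by exists #|active u1|; apply/asboolP; exists u1.
have leP k : P k -> (k <= #|I|)%N.
  by move=> /asboolP[u [_ _ <-]]; exact: max_card.
case: (ex_maxnP exP leP) => m /asboolP[u [[Su lu] u0 mE]] maxm.
have main w : polyhedral_cone w -> w != 0 -> active u \subset active w ->
    exists s, w = s *: u.
  move=> [Sw lw] w0 uw.
  have [i0 i0w] : exists i, l i w != 0.
    apply: contrapT => /forallNP lw0.
    have lw_eq0 i : l i w = 0 by apply/eqP; apply: contrapT => /negP /(lw0 i).
    have CNw : polyhedral_cone (- w).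
      split=> [|i]; last by rewrite linearN lw_eq0 oppr0.
      have S0 : S 0 by have := S_lin (-1) Sw Sw; rewrite scaleN1r addNr.
      by rewrite -scaleN1r -[_ *: _]addr0; exact: S_lin.
    have := l0_gt0 _ CNw; rewrite oppr_eq0 linearN => /(_ w0).
    by rewrite oppr_gt0 => /(lt_trans (l0_gt0 w (conj Sw lw) w0)); rewrite ltxx.
  (* The constraint hit first when moving from [u] in the direction [- w]. *)
  have : exists2 i, l i w != 0 & forall j, l j w != 0 ->
      l i u / l i w <= l j u / l j w.
    case: (@arg_minP _ _ _ i0 (fun i => l i w != 0)
      (fun i => l i u / l i w)) => //.
    by move=> i iw H; exists i.
  move=> [i iw mini].
  set t := l i u / l i w in mini.
  have Cd : polyhedral_cone (u - t *: w).
    split=> [|j]; first by rewrite addrC -scaleNr; exact: S_lin.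
    rewrite linearB linearZ /= subr_ge0.
    have [->|jw] := eqVneq (l j w) 0; first by rewrite mulr0.
    by rewrite -ler_pdivlMr ?mini// lt_def jw lw.
  have iu : i \notin active u.
    by apply: contra iw => /(fintype.subsetP uw); rewrite inE.
  have [d0|dn0] := eqVneq (u - t *: w) 0.
    have ut : u = t *: w by apply/eqP; rewrite -subr_eq0 d0.
    have tn0 : t != 0 by apply: contra_neq u0 => t0; rewrite ut t0 scale0r.
    by exists t^-1; rewrite ut scalerA mulVf// scale1r.
  have : (#|active (u - t *: w)%R| <= m)%N.
    by apply: maxm; apply/asboolP; exists (u - t *: w).
  rewrite leqNgt -mE => /negP[]; apply: proper_card; apply/properP; split.
    apply/fintype.subsetP => j ju; have := fintype.subsetP uw _ ju; move: ju.
    rewrite !inE => /eqP ju /eqP jw.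
    by rewrite linearB linearZ /= ju jw mulr0 subr0.
  by exists i => //; rewrite inE linearB linearZ /= /t divfK// subrr.
exists u; split=> // a b [Sa la] [Sb lb] uab.
have [a0|an0] := eqVneq a 0; first by exists 0; rewrite a0 scale0r.
apply: main => //; apply/fintype.subsetP => i; rewrite !inE uab linearD /=.
by rewrite paddr_eq0// => /andP[].
Qed.

End PolyhedralCone.

(** * Coordinates on the space of characters *)

Section Euclidean.
Variables (R : realType) (n : nat).
Implicit Types u v w : 'rV[R]_n.

Lemma dotDl u v w : dot (u + v) w = dot u w + dot v w.
Proof. by rewrite -big_split; apply: eq_bigr => i _; rewrite mxE mulrDl. Qed.

Lemma dotZl a u w : dot (a *: u) w = a * dot u w.
Proof. by rewrite /dot mulr_sumr; apply: eq_bigr => i _; rewrite mxE mulrA. Qed.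

Lemma dot0l w : dot 0 w = 0.
Proof. by rewrite -(scale0r 0) dotZl mul0r. Qed.

Lemma dotC u v : dot u v = dot v u.
Proof. by apply: eq_bigr => i _; rewrite mulrC. Qed.

Lemma enorm_gt0 u : u != 0 -> 0 < enorm u.
Proof.
move=> u0; have sq i : 0 <= u 0 i * u 0 i by rewrite -expr2 sqr_ge0.
rewrite sqrtr_gt0 lt_def sumr_ge0// andbT.
apply: contra u0 => /eqP /psumr_eq0P d0; apply/eqP/rowP => i; rewrite mxE.
by have /eqP := d0 (fun j _ => sq j) i isT; rewrite mulf_eq0 orbb => /eqP.
Qed.

Lemma enormZ a u : 0 <= a -> enorm (a *: u) = a * enorm u.
Proof.
move=> a0; rewrite /enorm dotZl dotC dotZl mulrA -expr2 sqrtrM ?sqr_ge0//.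
by rewrite sqrtr_sqr ger0_norm.
Qed.

Lemma normalizeZ a u : 0 < a -> normalize (a *: u) = normalize u.
Proof.
move=> a0; rewrite /normalize enormZ ?ltW// scalerA invfM mulrAC mulVf ?mul1r//.
by rewrite gt_eqF.
Qed.

Lemma normalizeK u : u != 0 -> u = enorm u *: normalize u.
Proof.
by move=> /enorm_gt0 u0; rewrite scalerA divff ?scale1r// gt_eqF.
Qed.

Lemma unit_sphere_normalize u : u != 0 -> unit_sphere (normalize u).
Proof.
move=> /enorm_gt0 u0.
by rewrite /unit_sphere /= enormZ ?invr_ge0 ?ltW// mulVf// gt_eqF.
Qed.

Lemma unit_sphere_dot v : unit_sphere v -> dot v v = 1.
Proof.
rewrite /unit_sphere /= /enorm => v1.
have vv : 0 <= dot v v by apply: sumr_ge0 => i _; rewrite -expr2 sqr_ge0.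
by rewrite -(sqr_sqrtr vv) v1 expr1n.
Qed.

Lemma tangent_hyperplaneE v u : unit_sphere v ->
  tangent_hyperplane v u <-> dot u v = 1.
Proof.
move=> /unit_sphere_dot v1; split=> [[w /= w0 <-]|u1].
  by rewrite dotDl w0 addr0.
exists (u - v); last by rewrite addrC subrK.
by rewrite /= dotDl -scaleN1r dotZl u1 v1 mulN1r subrr.
Qed.

End Euclidean.

Section Coordinates.
Variables (R : realType) (G : groupType) (n : nat) (x : 'I_n -> G).
Implicit Types chi psi : G -> R^o.

Definition coord_form (w : 'rV[R]_n) (chi : G -> R^o) : R :=
  dot (char_coord x chi) w.

Lemma char_coordZ a chi : char_coord x (a *: chi) = a *: char_coord x chi.
Proof. by apply/rowP => i; rewrite !mxE. Qed.

Lemma char_coordD chi psi :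
  char_coord x (chi + psi) = char_coord x chi + char_coord x psi.
Proof. by apply/rowP => i; rewrite !mxE. Qed.

Lemma coord_form_is_linear w : GRing.linear_for *%R (coord_form w).
Proof.
by move=> a f g; rewrite /coord_form char_coordD char_coordZ dotDl dotZl.
Qed.

HB.instance Definition _ w :=
  GRing.isLinear.Build R (G -> R^o) R *%R (coord_form w)
    (coord_form_is_linear w).

Definition additive_characters : set (G -> R^o) :=
  [set chi | additive_character (chi : G -> R)].

Lemma additive_characters_lin (a : R) chi psi :
  additive_characters chi -> additive_characters psi ->
  additive_characters (a *: chi + psi).
Proof.
move=> chiM psiM g h.
by rewrite !fctE /= chiM psiM scalerDr addrACA.
Qed.

Lemma additive_characters0 : additive_characters 0.
Proof. by move=> g h; exact/esym/addr0. Qed.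

Hypothesis hx : basis_mod_torsion x.

Lemma char_coord_inj chi psi :
  additive_characters chi -> additive_characters psi ->
  char_coord x chi = char_coord x psi -> chi = psi.
Proof.
move=> chiM psiM e; apply/funext => g; apply/eqP; rewrite -subr_eq0 addrC.
have dM := additive_characters_lin (-1) psiM chiM.
rewrite -[_ + _]/((- psi + chi) g) -scaleN1r.
apply/eqP/(character_basis_eq0 dM hx) => i; have /rowP/(_ i) := e; rewrite !mxE.
by rewrite scaleN1r fctE => ->; rewrite addNr.
Qed.

Lemma nzchar_additive (c : nzchar R G) : additive_characters c.
Proof. by have /set_mem[] := nzcharP c. Qed.

Lemma nzchar_neq0 (c : nzchar R G) : (c : G -> R^o) != 0.
Proof.
have /set_mem[_ [g cg]] := nzcharP c.
by apply: contra_neq cg => /(congr1 (@^~ g)).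
Qed.

Lemma exists_nzchar chi : additive_characters chi -> chi != 0 ->
  exists c : nzchar R G, c = chi :> (G -> R).
Proof.
move=> chiM chi0.
have chiP : (chi : G -> R) \in @nonzero_character R G.
  apply/mem_set; split=> //; apply: contrapT => /forallNP H.
  move/eqP: chi0; apply; apply/funext => g.
  by apply/eqP; apply: contrapT => /negP /(H g).
by exists (NzChar chiP).
Qed.

Lemma char_coord_neq0 (c : nzchar R G) : char_coord x c != 0.
Proof.
apply: contra_neq (nzchar_neq0 c) => c0; apply: char_coord_inj.
- exact: nzchar_additive.
- exact: additive_characters0.
- by rewrite c0; apply/rowP => i; rewrite !mxE.
Qed.

Lemma sphere_coord_inj (p q : char_sphere R G) :
  sphere_coord x p = sphere_coord x q -> p = q.
Proof.
rewrite -[p]reprK -[q]reprK => e; apply/eqmodP/asboolP.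
have := normalizeK (char_coord_neq0 (repr q)).
move: e; rewrite !sphere_coordE => <- qE.
have p0 := enorm_gt0 (char_coord_neq0 (repr p)).
have q0 := enorm_gt0 (char_coord_neq0 (repr q)).
exists (enorm (char_coord x (repr q)) / enorm (char_coord x (repr p))).
  by rewrite divr_gt0.
have : (enorm (char_coord x (repr q)) / enorm (char_coord x (repr p))) *:
   (repr p : G -> R^o) = repr q :> (G -> R^o).
  apply: char_coord_inj.
  - rewrite -[_ *: _]addr0; apply: additive_characters_lin.
      exact: nzchar_additive.
    exact: additive_characters0.
  - exact: nzchar_additive.
  - by rewrite char_coordZ [RHS]qE -scalerA.
by move=> E g; exact: (congr1 (@^~ g) E).
Qed.

End Coordinates.

(** * The cone over an invariant polytope *)

Section Polytope.
Variables (R : realType) (G : groupType) (n : nat) (x : 'I_n -> G).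
Hypothesis hx : basis_mod_torsion x.
Variables (K : set (char_sphere R G)) (ws : seq 'rV[R]_n).
Hypothesis KE : sphere_coord x @` K =
  @unit_sphere R n `&` \bigcap_(w in [set` ws]) closed_hemisphere w.

(** The additive functions representing the points of [K], together with [0],
    described by the hemispheres that cut out [K]. *)
Definition polytope_cone : set (G -> R^o) :=
  polyhedral_cone (@additive_characters R G)
    (fun i => coord_form x (tnth (in_tuple ws) i)).

Lemma polytope_coneP (c : nzchar R G) :
  K (char_class c) <-> polytope_cone (c : G -> R).
Proof.
have c0 := enorm_gt0 (char_coord_neq0 hx c).
have KP : K (char_class c) <->
    (sphere_coord x @` K) (sphere_coord x (char_class c)).
  split=> [Kc|[q Kq e]]; first by exists (char_class c).
  by rewrite -(sphere_coord_inj hx e).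
rewrite KP KE sphere_coordE; split=> [[_ H]|[_ H]].
  split=> [|i]; first exact: nzchar_additive.
  have /= := H _ (mem_tnth i (in_tuple ws)).
  by move=> [_]; rewrite dotZl pmulr_rge0// invr_gt0.
have u1 := unit_sphere_normalize (char_coord_neq0 hx c).
split=> // w /= /(tnthP (in_tuple ws))[i ->]; split=> //.
by rewrite dotZl mulr_ge0 ?invr_ge0 ?(ltW c0)//; exact: H.
Qed.

Lemma polytope_cone_scale (a : R) (chi : G -> R^o) :
  0 <= a -> polytope_cone chi -> polytope_cone (a *: chi).
Proof.
move=> a0 [Sc lc]; split=> [|i]; last by rewrite linearZ mulr_ge0 //; exact: lc.
rewrite -[_ *: _]addr0; apply: additive_characters_lin => //.
exact: additive_characters0.
Qed.

Lemma polytope_cone_comp (phi : group_aut G) (chi : G -> R^o) :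
  aut_invariant K -> polytope_cone chi -> polytope_cone (chi \o phi).
Proof.
move=> Kinv Cchi; have [chi0|chi0] := eqVneq chi 0.
  by have -> : chi \o phi = chi by rewrite chi0.
have [c cE] := exists_nzchar (proj1 Cchi) chi0.
rewrite -cE in Cchi *.
have /polytope_coneP Kc := Cchi.
apply: (proj1 (polytope_coneP (pullback phi c))).
by rewrite -sphere_mapE -(Kinv phi); exists (char_class c).
Qed.

(** Composition with [phi] maps the cone onto itself: its inverse is composition
    with the inverse automorphism, which also leaves [K] invariant. *)
Lemma extreme_comp (phi : group_aut G) (chi : G -> R^o) : aut_invariant K ->
  extreme polytope_cone chi -> extreme polytope_cone (chi \o phi).
Proof.
move=> Kinv [Cchi chi0 ext].
have [psi [phiK psiK]] := exists_inverse_aut phi.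
split; first exact: polytope_cone_comp.
  apply: contra_neq chi0 => e; apply/funext => g.
  by rewrite -(psiK g); exact: (congr1 (@^~ (psi g)) e).
move=> a b Ca Cb e.
have [|||s sE] := ext (a \o psi) (b \o psi).
- exact: polytope_cone_comp.
- exact: polytope_cone_comp.
- by apply/funext => g; rewrite -(psiK g); have := congr1 (@^~ (psi g)) e;
    rewrite /= psiK.
exists s; apply/funext => g; rewrite -(phiK g).
by have := congr1 (@^~ (phi g)) sE; rewrite /= !phiK.
Qed.

Variable v : 'rV[R]_n.
Hypothesis v1 : unit_sphere v.
Hypothesis Kv : K `<=` sphere_open_hemisphere x v.

Lemma polytope_cone_gt0 (chi : G -> R^o) :
  polytope_cone chi -> chi != 0 -> 0 < coord_form x v chi.
Proof.
move=> Cchi chi0; have [c cE] := exists_nzchar (proj1 Cchi) chi0.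
rewrite -cE in Cchi *.
have /polytope_coneP /Kv := Cchi.
rewrite /sphere_open_hemisphere /open_hemisphere /= sphere_coordE => -[_].
by rewrite dotZl pmulr_rgt0// invr_gt0; exact: enorm_gt0 (char_coord_neq0 hx c).
Qed.

(** Radial projection identifies a slice of the cone with [K], so linear
    decompositions in the Euclidean model of [K] can be carried out on
    characters. *)
Lemma flatten_polytopeP (A : 'rV[R]_n) :
  flatten_polytope v (sphere_coord x @` K) A <->
  dot A v = 1 /\ exists2 a, polytope_cone a & char_coord x a = A.
Proof.
rewrite /flatten_polytope.
split=> [[/(tangent_hyperplaneE _ v1) Av]|[Av [a Ca aA]]].
  move=> [q Kq qA]; split=> //.
  have A0 : A != 0.
    by apply: contra_eq_neq Av => ->; rewrite dot0l eq_sym oner_eq0.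
  rewrite -[q]reprK in Kq qA; have {}Kq := proj1 (polytope_coneP _) Kq.
  exists ((enorm A / enorm (char_coord x (repr q))) *: (repr q : G -> R^o)).
    apply: polytope_cone_scale => //.
    by rewrite divr_ge0// ltW// enorm_gt0// char_coord_neq0.
  by rewrite char_coordZ -scalerA [RHS](normalizeK A0) -qA sphere_coordE.
split; first exact/tangent_hyperplaneE.
have a0 : a != 0.
  apply: contra_eq_neq Av => a0; rewrite -aA a0.
  have -> : char_coord x (0 : G -> R^o) = 0 by apply/rowP => i; rewrite !mxE.
  by rewrite dot0l eq_sym oner_eq0.
have [c cE] := exists_nzchar (proj1 Ca) a0; rewrite -cE in Ca aA.
exists (char_class c); first exact/polytope_coneP.
by rewrite sphere_coordE aA.
Qed.

(** Rescale [c] into the slice where the linear form of the hemisphere is [1].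
    The endpoints of a segment of the slice through that point decompose [c]
    inside the cone, so they lie on the ray of [c], and the ray meets the slice
    only once. *)
Lemma extreme_vertex (c : nzchar R G) :
  extreme polytope_cone (c : G -> R) -> vertices x v K (char_class c).
Proof.
move=> [Cc c0 ext].
have cv := polytope_cone_gt0 Cc c0; set m := coord_form x v c in cv.
exists (m^-1 *: char_coord x c); last first.
  by rewrite normalizeZ ?invr_gt0// sphere_coordE.
have side (A : 'rV[R]_n) (t : R) (B : 'rV[R]_n) :
    flatten_polytope v (sphere_coord x @` K) A ->
    flatten_polytope v (sphere_coord x @` K) B ->
    0 < t < 1 -> m^-1 *: char_coord x c = t *: A + (1 - t) *: B ->
    A = m^-1 *: char_coord x c.
  move=> /flatten_polytopeP[Av [a Ca aA]] /flatten_polytopeP[_ [b Cb bB]].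
  move=> /andP[t0 t1] e.
  have [|||s sE] := ext ((m * t) *: a) ((m * (1 - t)) *: b).
  - by apply: polytope_cone_scale => //; rewrite ltW// mulr_gt0.
  - by apply: polytope_cone_scale => //; rewrite ltW// mulr_gt0// subr_gt0.
  - apply: (char_coord_inj hx).
    + exact: (proj1 Cc).
    + apply: additive_characters_lin; first exact: (proj1 Ca).
      apply: (proj1 (polytope_cone_scale _ Cb)).
      by rewrite ltW// mulr_gt0// subr_gt0.
    + rewrite char_coordD !char_coordZ aA bB -!scalerA -scalerDr -e scalerA.
      by rewrite divff ?scale1r// gt_eqF.
  have := congr1 (char_coord x) sE; rewrite !char_coordZ aA => AE.
  have := congr1 (fun u => dot u v) AE; rewrite !dotZl Av mulr1.
  rewrite -[dot (char_coord x c) v]/m => sm.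
  have mt : m * t != 0 by rewrite gt_eqF// mulr_gt0.
  apply: (scalerI mt); rewrite AE scalerA sm mulfK//.
  by rewrite gt_eqF.
split; last first.
  move=> A B t FA FB /andP[t0 t1] e; split.
    by apply: (side A t B); rewrite ?t0.
  apply: (side B (1 - t) A) => //.
    by rewrite subr_gt0 t1 ltrBlDr ltrDl t0.
  by rewrite subKr addrC.
apply/flatten_polytopeP; split.
  by rewrite dotZl mulVf// gt_eqF.
exists (m^-1 *: (c : G -> R^o)); last by rewrite char_coordZ.
by apply: polytope_cone_scale => //; rewrite invr_ge0 ltW.
Qed.

Hypothesis Krat : vertices x v K `<=` @rational_point R G.

(** Rationality is assumed for the vertices of [K], that is for rays; on each
    extreme ray some character is then rational valued. *)
Lemma extreme_rational (chi : G -> R^o) : extreme polytope_cone chi ->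
  exists2 s : R, 0 < s & forall g, exists q : rat, s * chi g = ratr q.
Proof.
move=> ext; have [Cchi chi0 _] := ext.
have [c cE] := exists_nzchar (proj1 Cchi) chi0; rewrite -cE in ext *.
have [psi e psiQ] := Krat (extreme_vertex ext).
have /asboolP[s s0 sE] : pos_prop c psi by apply/eqmodP.
by exists s => // g; rewrite sE.
Qed.

(** Extreme characters are permuted up to scale by [phi].  On an orbit that
    closes up the scale is [1], by rationality, and summing over the orbit
    yields a fixed vector. *)
Lemma exists_fixed_character (phi : group_aut G) :
  finitely_generated G -> K !=set0 -> aut_invariant K ->
  exists chi : G -> R, [/\ additive_character chi, exists g, chi g != 0 &
    forall g, chi (phi g) = chi g].
Proof.
move=> fgG [p Kp] Kinv.
have [||chi0 ext0] := exists_extreme (@additive_characters_lin R G)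
    (l := fun i => coord_form x (tnth (in_tuple ws) i)) (l0 := coord_form x v).
- exact: polytope_cone_gt0.
- exists (repr p : G -> R); last exact: nzchar_neq0.
  by apply/polytope_coneP; rewrite /char_class reprK.
pose u k : G -> R^o := chi0 \o iter k phi.
have uS k : u k.+1 = u k \o phi.
  by apply/funext => g; rewrite /u /= -iterS iterSr.
have uext k : extreme polytope_cone (u k).
  by elim: k => [//|k IH]; rewrite uS; exact: extreme_comp.
have [i [j [r [ij jE]]]] :=
  pigeonhole_extreme (@additive_characters_lin R G) uext.
have [Ci ui0 _] := uext i; have [Cj uj0 _] := uext j.
have ivM : additive_character (u i) := proj1 Ci.
have uvg k : 0 < coord_form x v (u k).
  by have [Ck uk0 _] := uext k; exact: polytope_cone_gt0.
have r0 : 0 < r.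
  by have := uvg j; rewrite jE linearZ /= pmulr_lgt0.
have uD k m g : u (k + m)%N g = u k (iter m phi g) by rewrite /u /= iterD.
have [s s0 sQ] := extreme_rational (uext i).
(* The power [phi ^ (j - i)] rescales [u i] by [r], hence also its rational
   multiple [s *: u i]. *)
have r1 : r = 1.
  apply: (@rational_character_scale_eq1 _ _ (s *: u i : G -> R^o)
    (iter (j - i) phi)) => //.
  - exact: (proj1 (polytope_cone_scale (ltW s0) Ci)).
  - apply: contrapT => /forallNP H; move/eqP: ui0; apply; apply/funext => g.
    apply/eqP; apply: contrapT => /negP gn0; apply: (H g).
    by rewrite mulf_neq0// gt_eqF.
  - have [psi [_ psiK]] := exists_inverse_aut phi.
    move=> g; exists (iter (j - i) psi g); elim: (j - i)%N => // k IH.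
    by rewrite iterSr [iter k.+1 psi g]iterS psiK.
  - move=> g; rewrite /= !fctE -uD subnKC ?(ltnW ij)// jE.
    by rewrite !fctE /GRing.scale /= mulrCA.
(* As [u j = u i], composing with [phi] rotates the terms of this sum. *)
exists (\sum_(i <= k < j) u k); split.
- apply: (big_ind (@additive_characters R G)).
  + exact: additive_characters0.
  + by move=> a b aM bM; rewrite -[a]scale1r; exact: additive_characters_lin.
  + by move=> k _; have [[]] := uext k.
- apply: contrapT => /forallNP H.
  have z : \sum_(i <= k < j) u k = 0 :> (G -> R^o).
    by apply/funext => g; apply/eqP; apply: contrapT => /negP /(H g).
  have := congr1 (coord_form x v) z; rewrite linear_sum linear0.
  apply/eqP; rewrite gt_eqF// big_ltn// ltr_pwDl ?uvg//.
  by apply: sumr_ge0 => k _; exact/ltW/uvg.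
- move=> g; rewrite !fct_sumE.
  rewrite (eq_bigr (fun k => u k.+1 g)); last by move=> k _; rewrite uS.
  have -> : \sum_(i <= k < j) u k.+1 g = \sum_(i.+1 <= k < j.+1) u k g.
    by rewrite big_add1.
  rewrite big_nat_recr//= [RHS]big_ltn// addrC; congr (_ + _).
  by rewrite jE r1 scale1r.
Qed.

End Polytope.

(** * Half-space graphs and generating sets *)

Lemma cayley_edgeP (G : groupType) (X : seq G) (g h : G) :
  reflect (exists2 y, y \in X & h = (g * y)%g \/ g = (h * y)%g)
    (cayley_edge X g h).
Proof.
apply: (iffP hasP) => [[y yX]|[y yX [->|->]]].
- by move=> /orP[/eqP ->|/eqP ->]; exists y; rewrite ?mulgVK; auto.
- by exists y; rewrite ?eqxx.
- by exists y; rewrite // mulgK eqxx orbT.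
Qed.

Lemma cayley_edge_sym (G : groupType) (X : seq G) : symmetric (cayley_edge X).
Proof.
move=> g h; apply/cayley_edgeP/cayley_edgeP => -[y yX H];
  by exists y => //; case: H; auto.
Qed.

Lemma cayley_edge_mull (G : groupType) (X : seq G) (b g h : G) :
  cayley_edge X (b * g)%g (b * h)%g = cayley_edge X g h.
Proof. by apply: eq_has => y; rewrite -!mulgA !(inj_eq (mulgI b)). Qed.

Section Walks.
Variables (R : realType) (G : groupType) (chi : G -> R).
Hypothesis chiM : additive_character chi.

Definition walk (X : seq G) (m : R) (g h : G) := exists p : seq G,
  [/\ path (cayley_edge X) g p, all (fun k => m <= chi k) p & last g p = h].

Lemma walk_trans X m g h k : walk X m g h -> walk X m h k -> walk X m g k.
Proof.
move=> [p [pp pm ph]] [q [qq qm qk]]; exists (p ++ q).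
by rewrite cat_path all_cat last_cat pp pm ph qq qm qk.
Qed.

Lemma walk_weaken X m m' g h : m' <= m -> walk X m g h -> walk X m' g h.
Proof.
move=> le_m [p [pp pm ph]]; exists p; split=> //.
by apply: sub_all pm => k; exact: le_trans.
Qed.

Lemma walk_sym X m g h : m <= chi g -> walk X m g h -> walk X m h g.
Proof.
move=> mg [p [pp pm <-]]; exists (rev (belast g p)); split.
- rewrite rev_path; apply: sub_path pp => a b; by rewrite cayley_edge_sym.
- rewrite all_rev; have : all (fun k => m <= chi k) (g :: p) by rewrite /= mg.
  by rewrite lastI all_rcons => /andP[].
- by case: p {pp pm} => //= a p; rewrite rev_cons last_rcons.
Qed.

Lemma walk_mull X b m g h :
  walk X m g h -> walk X (chi b + m) (b * g)%g (b * h)%g.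
Proof.
move=> [p [pp pm <-]]; exists [seq (b * k)%g | k <- p]; split.
- by rewrite path_map; apply: sub_path pp => u v /=; rewrite cayley_edge_mull.
- by rewrite all_map; apply: sub_all pm => k /=; rewrite chiM lerD2l.
- by rewrite last_map.
Qed.

Lemma exists_walk Y g : generates Y -> exists m, walk Y m 1%g g.
Proof.
move=> gY; move: g; apply: (generates_ind gY) => [|a b [m wa] [m' wb]|y yY].
- by exists 0, [::].
- have wb' : walk Y (Num.min m' 0) b 1%g.
    by apply: walk_sym; rewrite ?(character1 chiM) ?ge_min ?lexx ?orbT//;
      apply: walk_weaken wb; rewrite ge_min lexx.
  have := walk_mull (a * b^-1)%g wb'; rewrite mulgVK mulg1.
  set m'' := (_ + _) => w; exists (Num.min m m'').
  by apply: walk_trans (walk_weaken _ wa) (walk_weaken _ w);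
    rewrite ge_min lexx ?orbT.
- exists (chi y), [:: y]; rewrite /= lexx !andbT; split=> //.
  by apply/cayley_edgeP; exists y => //; left; rewrite mul1g.
Qed.

Lemma exists_uniform_walk (X Y : seq G) : generates Y ->
  exists2 c : R, 0 <= c & forall y, y \in X -> walk Y (- c) 1%g y.
Proof.
move=> gY; elim: X => [|y X [c c0 cX]]; first by exists 0.
have [m w] := exists_walk y gY.
exists (Num.max c (- m)); first by rewrite le_max c0.
move=> z; rewrite inE => /orP[/eqP ->|/cX wz].
  by apply: walk_weaken w; rewrite lerNl le_max lexx orbT.
by apply: walk_weaken wz; rewrite lerN2 le_max lexx.
Qed.

(** Replacing each edge by a walk in the other generators lowers the height by
    at most [c]. *)
Lemma walk_subst (X Y : seq G) c g h :
  (forall y, y \in X -> walk Y (- c) 1%g y) -> 0 <= c -> c <= chi g ->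
  walk X c g h -> walk Y 0 g h.
Proof.
move=> wX c0 cg [p [pp pc <-]]; elim: p g cg pp pc => [|k p IH] g cg /=.
  by exists [::].
move=> /andP[/cayley_edgeP[y yX gk] pp] /andP[ck pc].
apply: walk_trans (IH _ ck pp pc).
have step a : c <= chi a -> walk Y 0 a (a * y)%g.
  move=> ca; have := walk_mull a (wX _ yX); rewrite mulg1.
  by apply: walk_weaken; rewrite subr_ge0.
case: gk => [->|->]; first exact: step.
by apply: walk_sym (step _ ck); exact: le_trans ck.
Qed.

Lemma exists_ascending_step (Y : seq G) : generates Y ->
  (exists g, chi g != 0) ->
  exists2 t, 0 < chi t & forall g, cayley_edge Y g (g * t)%g.
Proof.
move=> gY [g0 g0n0].
have [y yY yn0] : exists2 y, y \in Y & chi y != 0.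
  apply: contrapT => H; move/eqP: g0n0; apply.
  move: g0; apply: (generates_ind gY) => [|a b a0 b0|y yY].
  - exact: character1.
  - by rewrite chiM characterV// a0 b0 subr0.
  - by apply/eqP; apply: contrapT => /negP yn0; apply: H; exists y.
have [y0|y0|y0] := ltgtP (chi y) 0; last by rewrite y0 eqxx in yn0.
- exists y^-1%g; first by rewrite characterV// oppr_gt0.
  by move=> g; apply/cayley_edgeP; exists y => //; right; rewrite mulgVK.
- by exists y => // g; apply/cayley_edgeP; exists y => //; left.
Qed.

Lemma ascending_walk Y t g N : 0 <= chi t ->
  (forall g, cayley_edge Y g (g * t)%g) -> walk Y (chi g) g (g * t ^+ N)%g.
Proof.
move=> t0 edge_t; elim: N => [|N IH].
  by exists [::]; rewrite expg0 mulg1.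
apply: walk_trans IH _; exists [:: (g * t ^+ N.+1)%g].
rewrite /= expgSr mulgA edge_t !chiM (characterX chiM).
by rewrite -addrA lerDl addr_ge0// mulrn_wge0.
Qed.

(** To join [g] and [h], climb along [Y]-edges to [g s] and [h s], where
    [chi s >= c] for the loss [c] of rewriting [X]-edges as [Y]-walks.  Left
    translation by [s] of an [X]-walk in the half-space from [s^-1 g s] to
    [s^-1 h s] joins these points at height at least [c]; rewritten in [Y] it
    stays at height at least [0]. *)
Lemma halfspace_connected_generators X Y : generates Y ->
  (exists g, chi g != 0) ->
  halfspace_connected X chi -> halfspace_connected Y chi.
Proof.
move=> gY chin0 Xconn g h g0 h0.
have [c c0 wX] := exists_uniform_walk X gY.
have [t t0 edge_t] := exists_ascending_step gY chin0.
pose N := Num.bound (c / chi t).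
pose s := (t ^+ N)%g.
have cs : c <= chi s.
  rewrite (characterX chiM) -mulr_natl -ler_pdivrMr// ltW//.
  by apply: archi_boundP; rewrite divr_ge0// ltW.
have up k : 0 <= chi k -> walk Y 0 k (k * s)%g.
  by move=> k0; apply: walk_weaken k0 (ascending_walk _ _ (ltW t0) edge_t).
have conj_ge0 k : 0 <= chi k -> 0 <= chi (s^-1 * (k * s))%g.
  by rewrite !chiM (characterV chiM) addrCA addNr addr0.
have wgh : walk X 0 (s^-1 * (g * s))%g (s^-1 * (h * s))%g.
  exact: Xconn (conj_ge0 _ g0) (conj_ge0 _ h0).
have := walk_mull s wgh; rewrite addr0 !mulVKg => w.
have cgs : c <= chi (g * s)%g by rewrite chiM; apply: ler_wpDl.
apply: walk_trans (up _ g0) _.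
apply: walk_trans (walk_subst wX c0 cgs (walk_weaken cs w)) _.
exact: walk_sym h0 (up _ h0).
Qed.
End Walks.

(** [phi] is an isomorphism from the Cayley graph for [X] to the one for
    [phi(X)], and it matches the two half-spaces. *)
Lemma halfspace_connected_comp (R : realType) (G : groupType) (X : seq G)
    (phi : group_aut G) (chi : G -> R) :
  halfspace_connected X (chi \o phi) ->
  halfspace_connected [seq phi y | y <- X] chi.
Proof.
have [psi [_ psiK]] := exists_inverse_aut phi.
move=> conn g h; rewrite -[g]psiK -[h]psiK => g0 h0.
have [p [pp p0 <-]] := conn _ _ g0 h0.
exists [seq phi k | k <- p]; split.
- rewrite path_map; apply: sub_path pp => a b /cayley_edgeP[y yX ab].
  apply/cayley_edgeP; exists (phi y); first exact: map_f.
  by case: ab => ->; rewrite gmulfM; auto.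
- by rewrite all_map; apply: sub_all p0.
- by rewrite last_map.
Qed.

(** Positive rescaling of a character does not change its half-space. *)
Lemma Sigma1P (R : realType) (G : groupType) (X : seq G) (c : nzchar R G) :
  Sigma1 X (char_class c) <-> halfspace_connected X c.
Proof.
split=> [[chi /eqmodP/asboolP[r r0 cE] conn] g h g0 h0|conn]; last by exists c.
have ge0E k : (0 <= chi k) = (0 <= c k) by rewrite -cE pmulr_rge0.
have [p [pp p0 ph]] : exists p : seq G, [/\ path (cayley_edge X) g p,
    all (fun k => 0 <= chi k) p & last g p = h] by apply: conn; rewrite ge0E.
exists p; split=> //; by rewrite -(eq_all ge0E).
Qed.

(** If the pullback of [chi] has a connected half-space for [X], then [chi] has
    one for [phi(X)], hence for [X].  So every automorphism maps the complement
    of [Sigma1] into itself, and applying this to the inverse automorphism gives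
    equality. *)
Lemma aut_invariant_Sigma1C (R : realType) (G : groupType) (X : seq G) :
  generates X -> aut_invariant (~` @Sigma1 R G X).
Proof.
move=> gX.
have sub (phi : group_aut G) p :
    ~ @Sigma1 R G X p -> ~ Sigma1 X (sphere_map phi p).
  rewrite -[p]reprK -/(char_class _) sphere_mapE => np /Sigma1P conn.
  apply: np; apply/Sigma1P.
  have /set_mem[cM cn0] := nzcharP (repr p).
  exact: halfspace_connected_generators (halfspace_connected_comp conn).
move=> phi; apply/seteqP; split=> [_ [p np <-]|p np]; first exact: sub.
have [psi [phiK psiK]] := exists_inverse_aut phi.
exists (sphere_map psi p); first exact: sub.
rewrite -[p]reprK -/(char_class _) !sphere_mapE; congr char_class.
by apply/val_inj/funext => g /=; rewrite phiK.
Qed.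

(** * The property R-infinity *)

Theorem theorem4p8 (R : realType) (G : groupType) (hG : finitely_generated G)
    (n : nat) (x : 'I_n -> G) (hx : basis_mod_torsion x) :
  ((exists K : set (char_sphere R G),
      rational_hemispherical_polytope x K /\ aut_invariant K) ->
    property_R_infty G) /\
  (forall X : seq G, generates X ->
    rational_hemispherical_polytope x (~` @Sigma1 R G X) ->
    property_R_infty G).
Proof.
have main (K : set (char_sphere R G)) :
    rational_hemispherical_polytope x K -> aut_invariant K ->
    property_R_infty G.
  move=> [K0 [ws [_ KE]] [v [v1 Kv Krat]]] Kinv phi.
  have [chi [chiM chin0 chiphi]] :=
    exists_fixed_character hx KE v1 Kv Krat phi hG K0 Kinv.
  exact: infinite_reidemeister chiM chin0 chiphi.
split=> [[K [HK Kinv]]|X gX HK]; first exact: main HK Kinv.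
exact: main HK (aut_invariant_Sigma1C R gX).
Qed.
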